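(* The set of all integer lattice points visible from the origin has asymptotic density $\dfrac{6}{\pi^2}$, i.e. $$\lim_{n\to\infty}\frac{|A_n|}{n^2}=\frac{6}{\pi^2},$$ where $A_n$ is the set of all points lying in the $n\times n$ grid centred at the origin which are visible from the origin.
   Context: Two integer lattice points $(a,b)$ and $(c,d)$ in the plane are said to be visible (from each other) if the line joining these two points does not contain any other lattice point in between. A lattice point is visible from the origin if it and $(0,0)$ are visible in this sense. The $n\times n$ grid centred at the origin consists of the lattice points $(x,y)\in\mathbb{Z}^2$ with $|x|\le n/2$ and $|y|\le n/2$ (so for $n=2k$ it is the $2k\times 2k$ grid $|x|,|y|\le k$, meeting all four quadrants); its total number of points is taken to be $n^2$, which is correct up to an error $O(n)$. *)

(* Defs.v *)
From HB Require Import structures.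
From mathcomp Require Import all_boot all_order all_algebra finmap.
From mathcomp Require Import all_classical all_reals all_analysis.

Set Implicit Arguments.
Unset Strict Implicit.
Unset Printing Implicit Defensive.

Import Order.TTheory GRing.Theory Num.Theory.
Import numFieldNormedType.Exports.

Local Open Scope classical_set_scope.
Local Open Scope ring_scope.

Definition point := (int * int)%type.

Definition origin : point := (0, 0).

Definition in_between (R : realType) (p q r : point) : Prop :=
  exists t : R, [/\ 0 < t < 1,
    r.1%:~R = p.1%:~R + t * (q.1%:~R - p.1%:~R) &
    r.2%:~R = p.2%:~R + t * (q.2%:~R - p.2%:~R)].

(* Visibility concerns two distinct points, so no point is visible from
   itself. *)
Definition visible (R : realType) (p q : point) : Prop :=
  p <> q /\ ~ exists r : point, in_between R p q r.

(* For even n = 2k this is |x|, |y| <= k, hence (n + 1)^2 points. *)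
Definition grid (R : realType) (n : nat) : set point :=
  [set p | `|p.1%:~R| <= n%:R / 2 :> R /\ `|p.2%:~R| <= n%:R / 2 :> R].

Definition visible_in_grid (R : realType) (n : nat) : set point :=
  [set p | grid R n p /\ visible R origin p].

(* [fset_set] sends infinite sets to the empty set; this lemma shows that
   the default is never used on [visible_in_grid]. *)
Lemma finite_visible_in_grid (R : realType) (n : nat) :
  finite_set (visible_in_grid R n).
Proof.
have fin_int : finite_set [set z : int | (absz z <= n)%N].
  apply: (@sub_finite_set _ _
    ((Posz @` `I_n.+1) `|` ((fun k => - Posz k) @` `I_n.+1))).
    move=> z /= zn; case: (intP z) zn => [|k|k] zn.
    - by left; exists 0%N.
    - by left; exists k.+1.
    - by right; exists k.+1 => //=; move: zn; rewrite abszN.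
  by rewrite finite_setU; split; apply: finite_image; apply: finite_II.
have bnd (z : int) : `|z%:~R| <= n%:R / 2 :> R -> (absz z <= n)%N.
  move=> h; rewrite -(ler_nat R) natr_absz -intr_norm /= in h *.
  apply: (le_trans h); rewrite ler_pdivrMr ?ltr0n// ler_peMr ?ler0n//.
  by rewrite ler1n.
apply: (sub_finite_set _ (finite_setX fin_int fin_int)).
by move=> [x y] /= [[/bnd hx /bnd hy] _]; split.
Qed.

(* Main.v *)
Require Import Defs.
From HB Require Import structures.
From mathcomp Require Import all_boot all_order all_algebra finmap.
From mathcomp Require Import all_classical all_reals all_analysis.
From mathcomp Require Import ring lra zify.

Set Implicit Arguments.
Unset Strict Implicit.
Unset Printing Implicit Defensive.

Import Order.TTheory GRing.Theory Num.Theory.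
Import numFieldNormedType.Exports.

Local Open Scope classical_set_scope.
Local Open Scope ring_scope.

(** A nonzero lattice point is visible from the origin exactly when its
    coordinates are coprime ([visible_originP]), and by symmetry the points of
    the grid of half-width [m = n./2] are, up to the four points on the axes,
    four copies of the [W m] coprime pairs of integers
    between 1 and [m] ([card_visible_in_grid]).

    Sorting all the pairs of integers between 1 and [m] by their gcd [d]
    gives the exact identity [\sum_(1 <= d <= m) W (m %/ d) = m ^ 2] ([sum_coprime_pairs]).
    If [W m] behaves like [c * m ^ 2], this forces [c * zeta(2) = 1].  That
    [W] really has such an asymptotic is obtained without Moebius inversion,
    by a contraction argument ([sum_quotient_inversion]).  Since
    [\sum_d (m %/ d) ^ 2 = zeta(2) * m ^ 2 + o(m ^ 2)], the error
    [f m = W m - m ^ 2 / zeta(2)] satisfies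
    [f m = o(m ^ 2) - \sum_(2 <= d <= m) f (m %/ d)].  A bound
    [`|f m| <= B * m ^ 2 + C] therefore improves to one whose leading constant
    is [(zeta(2) - 1) * B], up to an arbitrarily small loss, and
    [zeta(2) - 1 <= 3 / 4 < 1]; iterating yields [f m = o(m ^ 2)].

    There remains the value [zeta(2) = pi ^ 2 / 6] ([cvg_zeta2_partial]).  The
    identity [1 / sin^2 x + 1 / cos^2 x = 4 / sin^2 (2 x)] evaluates in closed
    form the sum of [1 / sin^2] over the dyadic angles
    [k * pi / 2 ^ n.+1], and [1 / x^2 <= 1 / sin^2 x <= 1 / x^2 + 1] turns
    this into an estimate of the partial sums of [\sum_k 1 / k ^ 2]. *)

(** * Coprime pairs, counted by gcd *)

Definition coprime_pairs (m : nat) : nat :=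
  (\sum_(1 <= x < m.+1) \sum_(1 <= y < m.+1) coprime x y)%N.

Lemma sum_multiples (d m : nat) (F : nat -> nat) : (0 < d)%N ->
  (\sum_(1 <= x < m.+1 | d %| x) F x =
   \sum_(1 <= k < (m %/ d).+1) F (d * k))%N.
Proof.
move=> d_gt0; rewrite big_mkcond.
elim: m => [|m IHm]; first by rewrite div0n !big_geq.
rewrite big_nat_recr//= IHm divnS//.
case: (boolP (d %| m.+1)%N) => [dm|_]; last by rewrite addn0 add0n.
rewrite add1n [RHS]big_nat_recr//=; congr (_ + F _)%N.
have -> : (m %/ d).+1 = (m.+1 %/ d)%N by rewrite divnS// dm add1n.
by rewrite mulnC divnK.
Qed.

(** Dividing both coordinates by [d] is a bijection from the pairs of gcd [d]
    and entries at most [m] onto the coprime pairs with entries at most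
    [m %/ d]. *)
Lemma count_gcd_eq (d m : nat) : (0 < d)%N ->
  (\sum_(1 <= x < m.+1) \sum_(1 <= y < m.+1) (gcdn x y == d) =
   coprime_pairs (m %/ d))%N.
Proof.
move=> d_gt0; rewrite /coprime_pairs.
transitivity (\sum_(1 <= x < m.+1 | d %| x)
    \sum_(1 <= y < m.+1 | d %| y) (gcdn x y == d))%N.
  rewrite [RHS]big_mkcond; apply: eq_bigr => x _.
  case: ifPn => dx; last first.
    by apply: big1 => y _; case: eqP => // <- in dx *; rewrite dvdn_gcdl in dx.
  rewrite [RHS]big_mkcond; apply: eq_bigr => y _.
  by case: ifPn => // dy; case: eqP => // E; rewrite -E dvdn_gcdr in dy.
rewrite sum_multiples//; apply: eq_bigr => x _.
rewrite sum_multiples//; apply: eq_bigr => y _.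
by rewrite -muln_gcdr -[X in _ == X]muln1 eqn_pmul2l.
Qed.

(** Each pair with entries between 1 and [m] is counted once, under the
    value [d] of its gcd. *)
Lemma sum_coprime_pairs (m : nat) :
  (\sum_(1 <= d < m.+1) coprime_pairs (m %/ d) = m ^ 2)%N.
Proof.
transitivity (\sum_(1 <= d < m.+1) \sum_(1 <= x < m.+1)
    \sum_(1 <= y < m.+1) (gcdn x y == d))%N.
  by apply: eq_big_nat => d /andP[d0 _]; rewrite count_gcd_eq.
rewrite exchange_big_nat/=.
transitivity (\sum_(1 <= x < m.+1) \sum_(1 <= y < m.+1) 1)%N; last first.
  by rewrite !sum_nat_const_nat subn1 muln1.
apply: eq_big_nat => x /andP[x_gt0 xm]; rewrite exchange_big_nat/=.
apply: eq_big_nat => y /andP[y_gt0 ym].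
have g0 : (0 < gcdn x y)%N by rewrite gcdn_gt0 x_gt0.
have gm : (gcdn x y < m.+1)%N by apply: leq_ltn_trans xm; rewrite dvdn_leq ?dvdn_gcdl.
rewrite (bigD1_seq (gcdn x y)) ?mem_index_iota ?g0 ?iota_uniq//= eqxx.
by rewrite big1// => d; rewrite eq_sym => /negbTE ->.
Qed.

Lemma coprime_pairs_le (m : nat) : (coprime_pairs m <= m ^ 2)%N.
Proof.
have -> : (m ^ 2 = \sum_(1 <= x < m.+1) \sum_(1 <= y < m.+1) 1)%N.
  by rewrite !sum_nat_const_nat subn1 muln1.
by apply: leq_sum => x _; apply: leq_sum => y _; apply: leq_b1.
Qed.

(** * Visible points of the grid *)

(** With [u * a + v * b = 1], the factor is [k = u * c + v * d]. *)
Lemma coprime_proportional (a b c d : int) :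
  coprimez a b -> a * d = c * b -> exists k : int, c = k * a /\ d = k * b.
Proof.
move=> /coprimezP[[u v]/= uv] e; exists (u * c + v * d).
split; rewrite -[LHS]mulr1 -uv.
- by rewrite !mulrDl mulrDr [c * (v * b)]mulrCA -e; ring.
- by rewrite !mulrDl mulrDr -[u * c * b]mulrA -e; ring.
Qed.

(** If the gcd [g] of the coordinates exceeds 1, then [p / g] blocks the view.
    Conversely a blocking point [t * p] with [p] primitive has [t] an integer,
    which cannot lie strictly between 0 and 1. *)
Lemma visible_originP (R : realType) (p : Defs.point) :
  visible R origin p <-> coprimez p.1 p.2.
Proof.
case: p => a b /=; split.
  move=> [/eqP p0 nop]; apply/negPn/negP => ncop; apply: nop.
  have g0 : gcdz a b != 0.
    apply: contraNneq p0; rewrite /origin => /eqP.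
    by rewrite gcdz_eq0 => /andP[/eqP -> /eqP ->].
  have g2 : 1 < (gcdz a b)%:~R :> R.
    by rewrite ltr1z; move: ncop g0; rewrite /coprimez /gcdz; case: gcdn => [|[|k]].
  have ea : a%:~R = (a %/ gcdz a b)%Z%:~R * (gcdz a b)%:~R :> R.
    by rewrite -intrM divzK// dvdz_gcdl.
  have eb : b%:~R = (b %/ gcdz a b)%Z%:~R * (gcdz a b)%:~R :> R.
    by rewrite -intrM divzK// dvdz_gcdr.
  exists ((a %/ gcdz a b)%Z, (b %/ gcdz a b)%Z), ((gcdz a b)%:~R^-1); split => /=.
  - by rewrite invr_gt0 invf_lt1 (lt_trans ltr01 g2) ?g2.
  - rewrite ea add0r subr0; field; lra.
  - rewrite eb add0r subr0; field; lra.
move=> cop; split.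
  by move=> e; move: cop; rewrite -[a]/((a, b).1) -[b in coprimez _ b]/((a, b).2) -e.
move=> [[c d] [t [/andP[t0 t1]]]] /=; rewrite !subr0 !add0r => ec ed.
have /(coprime_proportional cop)[k [ck dk]] : a * d = c * b.
  by apply: (@intr_inj R); rewrite !intrM ec ed; ring.
have kt : k%:~R = t.
  have /orP[a0|b0] : (a != 0) || (b != 0).
    by rewrite -negb_and; apply/negP => /andP[/eqP a0 /eqP b0]; move: cop; rewrite a0 b0.
  - by apply: (@mulIf _ (a%:~R : R)); rewrite ?intr_eq0// -intrM -ck.
  - by apply: (@mulIf _ (b%:~R : R)); rewrite ?intr_eq0// -intrM -dk.
by move: t0 t1; rewrite -kt ltr0z ltrz1; lia.
Qed.

Lemma gridE (R : realType) (n : nat) (p : Defs.point) :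
  grid R n p <-> (absz p.1 <= n./2)%N /\ (absz p.2 <= n./2)%N.
Proof.
have E (z : int) : (`|z%:~R| <= n%:R / 2 :> R) = (absz z <= n./2)%N.
  rewrite -intr_norm -abszE ler_pdivlMr//.
  rewrite -[_ * 2]/((absz z)%:R * 2%:R) -natrM ler_nat.
  by rewrite muln2 geq_half_double.
by rewrite /grid/= !E.
Qed.

(** Since [Negz k] is [- k.+1], the second range has one element less. *)
Definition int_range (m : nat) : seq int :=
  [seq Posz k | k <- iota 0 m.+1] ++ [seq Negz k | k <- iota 0 m].

Lemma mem_int_range (m : nat) (z : int) : (z \in int_range m) = (absz z <= m)%N.
Proof.
rewrite mem_cat; case: z => k.
  rewrite mem_map; last by move=> ? ? [].
  rewrite mem_iota/= ltnS; case: (k <= m)%N => //=.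
  by apply/negbTE/negP => /mapP[].
rewrite orbC mem_map; last by move=> ? ? [].
rewrite mem_iota/=; case: (k < m)%N => //=.
by apply/negbTE/negP => /mapP[].
Qed.

Lemma uniq_int_range (m : nat) : uniq (int_range m).
Proof.
rewrite cat_uniq !map_inj_uniq ?iota_uniq ?andbT//=; try by move=> ? ? [].
by apply/hasPn => _ /mapP[k _ ->]; apply/negP => /mapP[].
Qed.

Lemma sum_int_range (m : nat) (f : nat -> nat) :
  (\sum_(z <- int_range m) f (absz z) = f 0 + 2 * \sum_(1 <= k < m.+1) f k)%N.
Proof.
rewrite big_cat !big_map.
rewrite -[iota 0 m.+1]/(index_iota 0 m.+1) big_nat_recl//.
rewrite (eq_bigr (fun k => f k.+1))//.
have -> : iota 0 m = index_iota 0 m by rewrite /index_iota subn0.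
by rewrite big_add1/= -addnA addnn mul2n.
Qed.

(** Summing the coprimality indicator over both signs of both coordinates
    leaves the four open quadrants and, as soon as the half-width is at least
    1, the four points at distance 1 on the axes. *)
Lemma card_visible_in_grid (R : realType) (n : nat) :
  #|` fset_set (visible_in_grid R n)| =
  (4 * coprime_pairs n./2 + 4 * (1 < n))%N.
Proof.
set m := n./2.
pose s := [seq p : Defs.point <- [seq (x, y) | x <- int_range m, y <- int_range m]
            | coprimez p.1 p.2].
have us : uniq s.
  rewrite filter_uniq// allpairs_uniq ?uniq_int_range//.
  by move=> [? ?] [? ?].
have -> : fset_set (visible_in_grid R n) = [fset p in s]%fset.
  apply/fsetP => p; rewrite in_fset_set; last exact: finite_visible_in_grid.
  rewrite !inE/= mem_filter; apply/idP/idP.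
    rewrite inE => -[/gridE[x y] /visible_originP ->]; rewrite andTb.
    by case: p x y => a b x y; apply: allpairs_f; rewrite mem_int_range.
  move=> /andP[cop /allpairsP[[a b] /= []]]; rewrite !mem_int_range => x y e.
  by rewrite inE; split; [apply/gridE; rewrite e|apply/visible_originP].
rewrite card_fseq undup_id// size_filter -sum1_count big_mkcond big_allpairs.
rewrite (eq_bigr (fun x => \sum_(y <- int_range m) coprime (absz x) (absz y)))%N;
  last first.
  move=> x _; apply: eq_bigr => y _.
  by rewrite -[coprimez _ _]/(coprime (absz x) (absz y)); case: coprime.
pose f x := (\sum_(y <- int_range m) coprime x (absz y))%N.
rewrite (sum_int_range m f).
have fE x : f x = (coprime x 0 + 2 * \sum_(1 <= y < m.+1) coprime x y)%N.
  exact: (sum_int_range m (fun y => nat_of_bool (coprime x y))).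
(* On an axis only the coordinate 1 gives a coprime pair. *)
have sum1 (g : nat -> nat) : g =1 (fun x => nat_of_bool (x == 1)) ->
    (\sum_(1 <= y < m.+1) g y = (1 < n))%N.
  move=> gE; rewrite /m; case: n @m {s us f fE} => [|[|n']] m /=.
  - by rewrite big_geq.
  - by rewrite big_geq.
  rewrite big_ltn// gE eqxx big_nat_cond big1// => y; rewrite andbT => /andP[y1 _].
  by rewrite gE gtn_eqF.
rewrite fE (sum1 (fun y => nat_of_bool (coprime 0 y))); last first.
  by move=> y; rewrite /coprime gcd0n.
under eq_bigr do rewrite fE.
rewrite big_split/= (sum1 (fun y => nat_of_bool (coprime y 0))); last first.
  by move=> y; rewrite /coprime gcdn0.
rewrite -big_distrr/= -/(coprime_pairs m).
lia.
Qed.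

(** * The sum of the inverse squares *)

Section Basel.
Variable R : realType.
Implicit Types x : R.

Lemma sin_le x : 0 < x -> sin x <= x.
Proof.
move=> x0.
have dsin y : y \in `]0, x[%R -> is_derive y 1 sin (cos y).
  by move=> _; exact: is_derive_sin.
have csin : {within `[0, x], continuous sin}.
  by apply: continuous_subspaceT => y; exact: continuous_sin.
have [c _] := MVT x0 dsin csin.
by rewrite sin0 !subr0 => ->; rewrite ler_piMl ?cos_le1// ltW.
Qed.

Lemma le_tan x : 0 < x < pi / 2 -> x <= tan x.
Proof.
move=> /andP[x0 xpi].
have cos_pos y : 0 <= y <= x -> 0 < cos y.
  by move=> /andP[y0 yx]; apply: cos_gt0_pihalf; have := @pi_gt0 R; lra.
have dtan y : y \in `]0, x[%R -> is_derive y 1 tan ((cos y) ^- 2).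
  rewrite in_itv/= => /andP[y0 yx].
  by apply: is_derive_tan; rewrite gt_eqF// cos_pos// !ltW.
have ctan : {within `[0, x], continuous tan}.
  apply: continuous_in_subspaceT => y; rewrite inE/= in_itv/= => yx.
  by apply: continuous_tan; rewrite gt_eqF// cos_pos.
have [c] := MVT x0 dtan ctan.
rewrite in_itv/= => /andP[c0 cx]; rewrite tan0 !subr0 => ->.
have cc : 0 < cos c by rewrite cos_pos// !ltW.
apply: ler_peMl; first exact: ltW.
by rewrite -exprVn exprn_ege1// invf_ge1// cos_le1.
Qed.

(** This is [sin x <= x <= tan x], the upper bound because
    [1 / sin^2 x = 1 / tan^2 x + 1]. *)
Lemma inv_sin2_bounds x : 0 < x < pi / 2 ->
  (x ^+ 2)^-1 <= (sin x ^+ 2)^-1 <= (x ^+ 2)^-1 + 1.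
Proof.
move=> xI; have /andP[x0 xpi] := xI.
have s0 : 0 < sin x by apply: sin_gt0_pihalf.
have c0 : 0 < cos x by apply: cos_gt0_pihalf; have := @pi_gt0 R; lra.
apply/andP; split.
  by rewrite lef_pV2 ?posrE ?exprn_gt0// lerXn2r ?nnegrE ?(ltW s0) ?(ltW x0)// sin_le.
have -> : (sin x ^+ 2)^-1 = (tan x ^+ 2)^-1 + 1.
  transitivity ((cos x ^+ 2 + sin x ^+ 2) / sin x ^+ 2).
    by rewrite cos2Dsin2 mul1r.
  by rewrite /tan; field; rewrite !gt_eqF.
have xt := le_tan xI; have t0 := lt_le_trans x0 xt.
by rewrite lerD2r lef_pV2 ?posrE ?exprn_gt0// lerXn2r ?nnegrE ?(ltW x0) ?(ltW t0).
Qed.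

Lemma inv_sin2_double x : 0 < x < pi / 2 ->
  (sin x ^+ 2)^-1 + (sin (pi / 2 - x) ^+ 2)^-1 = 4 / sin (x *+ 2) ^+ 2.
Proof.
move=> xI; have /andP[x0 xpi] := xI.
have s0 : 0 < sin x by apply: sin_gt0_pihalf.
have c0 : 0 < cos x by apply: cos_gt0_pihalf; have := @pi_gt0 R; lra.
rewrite sinB sin_pihalf cos_pihalf mul1r mul0r subr0 sin_mulr2n.
transitivity ((cos x ^+ 2 + sin x ^+ 2) / (sin x ^+ 2 * cos x ^+ 2)).
  by field; rewrite !gt_eqF.
by rewrite cos2Dsin2 -mulr_natr; field; rewrite !gt_eqF.
Qed.

(** At [x = pi / 4] both terms of [inv_sin2_double] coincide. *)
Lemma inv_sin2_piquarter : (sin (pi / 4 : R) ^+ 2)^-1 = 2.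
Proof.
have := @inv_sin2_double (pi / 4).
have -> : pi / 2 - pi / 4 = pi / 4 :> R by field.
have -> : (pi / 4) *+ 2 = pi / 2 :> R by rewrite -mulr_natr; field.
rewrite sin_pihalf expr1n divr1 => H.
suff : (sin (pi / 4 : R) ^+ 2)^-1 + (sin (pi / 4 : R) ^+ 2)^-1 = 4 by lra.
by apply: H; have := @pi_gt0 R; lra.
Qed.

Let angle n k : R := k%:R * pi / (2 ^ n.+1)%:R.

Lemma angle_bounds n k : (0 < k < 2 ^ n)%N -> 0 < angle n k < pi / 2.
Proof.
move=> /andP[k0 kn]; have pi0 := @pi_gt0 R.
rewrite /angle divr_gt0 ?mulr_gt0 ?ltr0n ?expn_gt0//=.
rewrite ltr_pdivrMr ?ltr0n ?expn_gt0// expnS natrM.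
have : k%:R < (2 ^ n)%:R :> R by rewrite ltr_nat.
by nra.
Qed.

(** Passing from [n] to [n.+1] halves the angles.  The angles [x] and
    [pi / 2 - x] of level [n.+1] pair up to 4 times the term of angle [2 * x]
    of level [n], and the unpaired middle angle [pi / 4] contributes 2, so
    the sum [T n] obeys [T n.+1 = 4 * T n + 2]. *)
Lemma sum_inv_sin2 n :
  \sum_(1 <= k < 2 ^ n) (sin (angle n k) ^+ 2)^-1 = 2 * ((4 ^ n)%:R - 1) / 3.
Proof.
elim: n => [|n IHn]; first by rewrite expn0 big_geq// expn0; lra.
have n1 : (1 <= 2 ^ n)%N by rewrite expn_gt0.
have Hn : (2 ^ n <= 2 ^ n.+1)%N by rewrite leq_exp2l.
have p0 : (2 ^ n)%:R != 0 :> R by rewrite pnatr_eq0 expn_eq0.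
rewrite (big_cat_nat (n := 2 ^ n))//= [X in _ + X]big_ltn ?ltn_exp2l//=.
have -> : angle n.+1 (2 ^ n) = pi / 4.
  by rewrite /angle !expnS !natrM; field; rewrite p0.
rewrite inv_sin2_piquarter.
(* Reversing the upper half of the sum aligns [x] with [pi / 2 - x]. *)
rewrite [X in _ + (_ + X)]big_nat_rev/=.
have -> : \sum_((2 ^ n).+1 <= i < 2 ^ n.+1)
   (sin (angle n.+1 ((2 ^ n).+1 + 2 ^ n.+1 - i.+1)) ^+ 2)^-1 =
   \sum_(1 <= k < 2 ^ n) (sin (pi / 2 - angle n.+1 k) ^+ 2)^-1.
  have e : ((2 ^ n).+1 = 1 + 2 ^ n)%N by [].
  rewrite [in LHS]e big_addn expnS mul2n -addnn addnK.
  apply: eq_big_nat => k /andP[k0 kn]; congr ((sin _ ^+ 2)^-1).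
  rewrite /angle.
  have -> : ((1 + 2 ^ n) + (2 ^ n + 2 ^ n) - (k + 2 ^ n).+1 = 2 ^ n.+1 - k)%N.
    by rewrite expnS; lia.
  rewrite natrB; last by rewrite (leq_trans _ Hn)// ltnW.
  by rewrite !expnS !natrM; field; rewrite p0.
rewrite [_ + (2 + _)]addrCA -big_split/=.
rewrite (eq_big_nat _ _ (F2 := fun k => 4 * (sin (angle n k) ^+ 2)^-1)).
  rewrite -big_distrr/= IHn expnS natrM; lra.
move=> k kn; rewrite inv_sin2_double; last first.
  by apply: angle_bounds; move: kn => /andP[-> /leq_trans->].
congr (_ / (sin _ ^+ 2)).
by rewrite /angle -mulr_natr (expnS _ n.+1) natrM; field; rewrite pnatr_eq0 expn_eq0.
Qed.


Definition zeta2_partial n : R := \sum_(1 <= k < n.+1) (k%:R ^+ 2)^-1.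

Lemma zeta2_partial_nondecreasing : nondecreasing_seq zeta2_partial.
Proof.
apply/nondecreasing_seqP => n.
by rewrite /zeta2_partial [leRHS]big_nat_recr//= lerDl invr_ge0 sqr_ge0.
Qed.

(** Summing [inv_sin2_bounds] over the [2 ^ n - 1] angles of level [n] compares
    the closed form of [sum_inv_sin2] with [4 * 4 ^ n / pi ^ 2] times the
    partial sum, at the cost of 1 per term. *)
Lemma zeta2_partial_dyadic n :
  zeta2_partial (2 ^ n).-1 <= pi ^+ 2 / 6
    <= zeta2_partial (2 ^ n).-1 + pi ^+ 2 / (2 ^ n)%:R.
Proof.
have pi0 := @pi_gt0 R.
rewrite /zeta2_partial prednK ?expn_gt0//.
set Z := \sum_(_ <= _ < _) _.
have n1 : (1 <= 2 ^ n)%N by rewrite expn_gt0.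
have p1 : 1 <= (2 ^ n)%:R :> R by rewrite ler1n.
set p := (2 ^ n)%:R in p1 *.
have sumE : \sum_(1 <= k < 2 ^ n) (angle n k ^+ 2)^-1 = 4 * p ^+ 2 / pi ^+ 2 * Z.
  rewrite big_distrr/=; apply: eq_big_nat => k /andP[k0 _].
  rewrite /angle expnS natrM -/p; field.
  by rewrite !gt_eqF ?ltr0n//; lra.
have S := sum_inv_sin2 n.
have a2 : (4 ^ n)%:R = p ^+ 2 :> R by rewrite /p -natrX -expnM mulnC expnM.
have lo : 4 * p ^+ 2 / pi ^+ 2 * Z <= 2 * (p ^+ 2 - 1) / 3.
  rewrite -sumE -a2 -S !big_nat; apply: ler_sum => k kn.
  by have /andP[] := inv_sin2_bounds (angle_bounds kn).
have hi : 2 * (p ^+ 2 - 1) / 3 <= 4 * p ^+ 2 / pi ^+ 2 * Z + p.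
  rewrite -sumE -a2 -S.
  apply: (@le_trans _ _ (\sum_(1 <= k < 2 ^ n) ((angle n k ^+ 2)^-1 + 1))).
    rewrite !big_nat; apply: ler_sum => k kn.
    by have /andP[] := inv_sin2_bounds (angle_bounds kn).
  rewrite big_split/= lerD2l big_const_nat iter_addr_0.
  by rewrite ler_nat leq_subr.
have ZE : Z = pi ^+ 2 / (4 * p ^+ 2) * (4 * p ^+ 2 / pi ^+ 2 * Z).
  by field; rewrite !gt_eqF//; lra.
have q0 : 0 < pi ^+ 2 / (4 * p ^+ 2).
  by rewrite divr_gt0 ?mulr_gt0 ?exprn_gt0//; lra.
apply/andP; split.
  rewrite ZE; apply: le_trans (ler_wpM2l (ltW q0) lo) _.
  have -> : pi ^+ 2 / (4 * p ^+ 2) * (2 * (p ^+ 2 - 1) / 3) =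
      pi ^+ 2 / 6 - pi ^+ 2 / (6 * p ^+ 2) by field; lra.
  by rewrite gerBl divr_ge0 ?sqr_ge0// mulr_ge0 ?sqr_ge0.
have := ler_wpM2l (ltW q0) hi; rewrite [X in _ <= X]mulrDr -ZE => h.
have e1 : pi ^+ 2 / (4 * p ^+ 2) * (2 * (p ^+ 2 - 1) / 3) =
      pi ^+ 2 / 6 - pi ^+ 2 / p * (6 * p)^-1 by field; lra.
have e2 : pi ^+ 2 / (4 * p ^+ 2) * p = pi ^+ 2 / p * 4^-1 by field; lra.
have r0 : 0 < pi ^+ 2 / p by rewrite divr_gt0 ?exprn_gt0//; lra.
have p6 : (6 * p)^-1 <= 6^-1 by rewrite lef_pV2 ?posrE; lra.
rewrite e1 e2 in h; set r := pi ^+ 2 / p in r0 h *; nra.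
Qed.

Lemma zeta2_partial_le n : zeta2_partial n <= pi ^+ 2 / 6.
Proof.
have /andP[+ _] := zeta2_partial_dyadic n; apply: le_trans.
apply: zeta2_partial_nondecreasing.
by rewrite -ltnS prednK ?expn_gt0// ltn_expl.
Qed.

(** The dyadic estimates pin down the limit, and monotonicity fills in the
    indices between powers of 2. *)
Theorem cvg_zeta2_partial : zeta2_partial @ \oo --> (pi ^+ 2 / 6 : R).
Proof.
apply/cvgrPdist_le => e e0.
pose n := (Num.trunc (pi ^+ 2 / e : R)).+1.
have pn : pi ^+ 2 / (2 ^ n)%:R <= e :> R.
  rewrite ler_pdivrMr ?ltr0n ?expn_gt0// mulrC -ler_pdivrMr//.
  apply: (@le_trans _ _ n%:R); last by rewrite ler_nat ltnW// ltn_expl.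
  by rewrite ltW// truncnS_gt.
near=> m.
have nm : ((2 ^ n).-1 <= m)%N by near: m; exact: nbhs_infty_ge.
have /andP[_ h] := zeta2_partial_dyadic n.
have h1 := zeta2_partial_nondecreasing nm.
rewrite ger0_norm ?subr_ge0 ?zeta2_partial_le//; lra.
Unshelve. all: by end_near. Qed.

(** The term at 2 is [1 / 4]; beyond it [1 / k ^ 2 <= 1 / (k - 1) - 1 / k]
    telescopes to at most [1 / 2].  The cruder telescoping from 2 on would give
    the bound 1, which is useless for the contraction below. *)
Lemma sum_inv_sqr_from2_le m :
  \sum_(2 <= k < m.+1) (k%:R ^+ 2)^-1 <= 3 / 4 :> R.
Proof.
case: m => [|[|m]]; try by rewrite big_geq//; lra.
suff : \sum_(2 <= k < m.+3) (k%:R ^+ 2)^-1 <= 3 / 4 - (m.+2%:R)^-1 :> R.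
  by move/le_trans; apply; rewrite gerBl invr_ge0.
elim: m => [|m IHm]; first by rewrite big_nat1; lra.
rewrite big_nat_recr//=.
have m0 : 0 < m.+2%:R :> R by [].
have e : m.+3%:R = m.+2%:R + 1 :> R by rewrite -natr1.
suff H : (m.+3%:R ^+ 2)^-1 <= (m.+2%:R)^-1 - (m.+3%:R)^-1 :> R.
  by apply: le_trans (lerD IHm H) _; rewrite addrA subrK.
rewrite e; set x : R := m.+2%:R in m0 *.
have -> : x^-1 - (x + 1)^-1 = (x * (x + 1))^-1 by field; lra.
have x1 : 0 < x + 1 by rewrite addr_gt0.
by rewrite lef_pV2 ?posrE ?mulr_gt0 ?exprn_gt0// expr2 ler_wpM2r ?(ltW x1)// lerDl.
Qed.

End Basel.

(** * Inverting sums over quotients *)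

Section Subquadratic.
Variable R : realType.
Implicit Types (f g : nat -> R) (m : nat).

(** The relation [f m = o(m ^ 2)], in a form that holds for all [m] and not just
    for large ones.  Such bounds can be summed over [d] at [m %/ d], which may be
    small even when [m] is large. *)
Definition subquadratic f :=
  forall e : R, 0 < e -> exists C, forall m, `|f m| <= e * m%:R ^+ 2 + C.

Lemma subquadratic_le f g :
  (forall m, `|f m| <= `|g m|) -> subquadratic g -> subquadratic f.
Proof.
by move=> fg sg e /sg[C H]; exists C => m; apply: le_trans (fg m) (H m).
Qed.

Lemma subquadraticD f g :
  subquadratic f -> subquadratic g -> subquadratic (fun m => f m + g m).
Proof.
move=> sf sg e e0; have e2 : 0 < e / 2 by lra.
have [C Hf] := sf _ e2; have [D Hg] := sg _ e2.
exists (C + D) => m; apply: le_trans (ler_normD _ _) _.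
have := lerD (Hf m) (Hg m); lra.
Qed.

Lemma subquadraticZ (k : R) f :
  subquadratic f -> subquadratic (fun m => k * f m).
Proof.
move=> sf e e0.
have k1 : 0 < `|k| + 1 by have := normr_ge0 k; lra.
have [C H] := sf (e / (`|k| + 1)) (divr_gt0 e0 k1).
exists ((`|k| + 1) * C) => m; rewrite normrM.
apply: (@le_trans _ _ ((`|k| + 1) * `|f m|)).
  by apply: ler_wpM2r => //; lra.
apply: le_trans (ler_wpM2l (ltW k1) (H m)) _.
by rewrite mulrDr lerD2r mulrA [_ * (e / _)]mulrC divfK// gt_eqF.
Qed.

(** By completing the square:
    [`|a| * m <= e * m ^ 2 + a ^ 2 / (4 * e)]. *)
Lemma subquadratic_linear (a b : R) : subquadratic (fun m => a * m%:R + b).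
Proof.
move=> e e0; exists (a ^+ 2 / (4 * e) + `|b|) => m.
apply: le_trans (ler_normD _ _) _; rewrite addrA lerD2r normrM normr_nat.
rewrite -subr_ge0 -[a ^+ 2]real_normK ?num_real//.
have -> : e * m%:R ^+ 2 + `|a| ^+ 2 / (4 * e) - `|a| * m%:R =
    (2 * e * m%:R - `|a|) ^+ 2 / (4 * e) by field; lra.
by rewrite divr_ge0 ?sqr_ge0//; lra.
Qed.

Lemma subquadratic_of_cvg0 (u : nat -> R) :
  u @ \oo --> (0 : R) -> subquadratic (fun m => m%:R ^+ 2 * u m).
Proof.
move=> /cvgr0Pnorm_le u0 e e0; have [N _ HN] := u0 e e0.
exists (\sum_(i < N) `|i%:R ^+ 2 * u i|) => m.
have [Nm|mN] := leqP N m.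
  rewrite -[leLHS]addr0 lerD ?sumr_ge0//.
  rewrite normrM normrX normr_nat mulrC ler_wpM2r ?sqr_ge0//; exact: HN.
rewrite -[leLHS]add0r lerD ?mulr_ge0 ?sqr_ge0// ?(ltW e0)//.
by rewrite (bigD1 (Ordinal mN))//= lerDl sumr_ge0.
Qed.

Lemma cvg_of_subquadratic (a : R) f :
  subquadratic (fun m => f m - a * m%:R ^+ 2) ->
  (fun m => f m / m%:R ^+ 2) @ \oo --> a.
Proof.
move=> sf; apply/cvgrPdist_le => e e0.
have e2 : 0 < e / 2 by lra.
have [C H] := sf _ e2; near=> m.
have m1 : (0 < m)%N by near: m; exact: nbhs_infty_gt.
have m0 : 0 < m%:R :> R by rewrite ltr0n.
have m2 : 0 < m%:R ^+ 2 :> R by rewrite exprn_gt0.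
have mm : m%:R <= m%:R ^+ 2 :> R by rewrite -natrX ler_nat -[leqLHS]expn1 leq_pexp2l.
have mC : C / (e / 2) <= m%:R by near: m; exact: nbhs_infty_ger.
rewrite distrC -[a](mulfK (lt0r_neq0 m2)) -mulrBl normrM.
rewrite [X in _ * X]gtr0_norm ?invr_gt0// ler_pdivrMr//.
apply: le_trans (H m) _.
move: mC; rewrite ler_pdivrMr//; nra.
Unshelve. all: by end_near. Qed.

Lemma subquadratic_half f : subquadratic f -> subquadratic (fun n => f n./2).
Proof.
move=> sf e e0; have [C H] := sf e e0; exists C => n.
apply: le_trans (H _) _; rewrite lerD2r ler_wpM2l ?(ltW e0)//.
rewrite lerXn2r ?nnegrE// ler_nat; lia.
Qed.

Lemma quotient_bounds m d : (0 < d)%N ->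
  (m %/ d)%:R <= (m%:R / d%:R : R) < (m %/ d)%:R + 1.
Proof.
move=> d0; rewrite ler_pdivlMr ?ltr_pdivrMr ?ltr0n// natr1 -!natrM.
by rewrite ler_nat ltr_nat leq_divM ltn_ceil.
Qed.

Lemma sqr_quotient_le m d : (m %/ d)%:R ^+ 2 <= m%:R ^+ 2 * (d%:R ^+ 2)^-1 :> R.
Proof.
case: d => [|d]; first by rewrite divn0 expr0n/= mulr_ge0 ?invr_ge0 ?sqr_ge0.
have /andP[h _] := quotient_bounds m (ltn0Sn d).
by rewrite -exprVn -exprMn lerXn2r ?nnegrE ?mulr_ge0 ?invr_ge0.
Qed.

(** Writing [x = m / d], the defect [x ^ 2 - (m %/ d) ^ 2] is at most [2 * x].
    The term [m * (2 / d)] is then split by [2 / d <= e + 1 / (e * d ^ 2)]: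
    summed over [d <= m], this costs [e * m ^ 2] plus a linear term, and avoids
    any estimate of the harmonic sum. *)
Lemma sqr_quotient_ge (e : R) m d : 0 < e -> (0 < d)%N ->
  m%:R ^+ 2 * (d%:R ^+ 2)^-1 - (m %/ d)%:R ^+ 2
    <= e * m%:R + e^-1 * m%:R * (d%:R ^+ 2)^-1.
Proof.
move=> e0 d0; have /andP[] := quotient_bounds m d0.
set q : R := (m %/ d)%:R; rewrite -exprVn; set v : R := d%:R^-1.
set x : R := m%:R => lo hi.
have v0 : 0 <= v by rewrite invr_ge0.
have x0 : 0 <= x by []. have q0 : 0 <= q by [].
have step : x ^+ 2 * v ^+ 2 - q ^+ 2 <= 2 * (x * v).
  have -> : x ^+ 2 * v ^+ 2 - q ^+ 2 = (x * v - q) * (x * v + q) by ring.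
  nra.
apply: le_trans step _; rewrite -subr_ge0.
have -> : e * x + e^-1 * x * v ^+ 2 - 2 * (x * v) = x * ((e - v) ^+ 2 / e).
  by field; lra.
by rewrite mulr_ge0// divr_ge0 ?sqr_ge0// ltW.
Qed.

(** The difference is [m ^ 2] times the tail of the series, which tends to 0,
    plus the rounding defects controlled by [sqr_quotient_ge]. *)
Lemma subquadratic_sum_sqr_quotient :
  subquadratic (fun m => pi ^+ 2 / 6 * m%:R ^+ 2
                         - \sum_(1 <= d < m.+1) (m %/ d)%:R ^+ 2).
Proof.
pose tail m := m%:R ^+ 2 * (pi ^+ 2 / 6 - zeta2_partial R m).
pose defect m : R :=
  \sum_(1 <= d < m.+1) (m%:R ^+ 2 * (d%:R ^+ 2)^-1 - (m %/ d)%:R ^+ 2).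
have E m : pi ^+ 2 / 6 * m%:R ^+ 2 - \sum_(1 <= d < m.+1) (m %/ d)%:R ^+ 2 =
    tail m + defect m.
  by rewrite /tail /defect sumrB -big_distrr/= -/(zeta2_partial R m); ring.
have stail : subquadratic tail.
  apply: subquadratic_of_cvg0; rewrite -[X in _ --> X](subrr (pi ^+ 2 / 6)).
  by apply: cvgB; [exact: cvg_cst|exact: cvg_zeta2_partial].
have sdefect : subquadratic defect.
  move=> e e0; have e2 : 0 < e / 2 by lra.
  have [C H] := subquadratic_linear ((e / 2)^-1 * (pi ^+ 2 / 6)) 0 e2.
  exists C => m; rewrite ger0_norm; last first.
    by apply: sumr_ge0 => d _; rewrite subr_ge0 sqr_quotient_le.
  apply: (@le_trans _ _ (\sum_(1 <= d < m.+1)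
      (e / 2 * m%:R + (e / 2)^-1 * m%:R * (d%:R ^+ 2)^-1))).
    by rewrite /defect !big_nat; apply: ler_sum => d /andP[d0 _]; exact: sqr_quotient_ge.
  rewrite big_split big_const_nat iter_addr_0 subn1 -big_distrr.
  rewrite -/(zeta2_partial R m) /= -[e / 2 * _ *+ _]mulr_natr.
  have := le_trans (ler_norm _) (H m); rewrite addr0.
  have : (e / 2)^-1 * m%:R * zeta2_partial R m <=
         (e / 2)^-1 * (pi ^+ 2 / 6) * m%:R.
    rewrite mulrAC ler_wpM2r// ler_wpM2l ?invr_ge0 ?(ltW e2)//.
    exact: zeta2_partial_le.
  lra.
by apply: subquadratic_le (subquadraticD stail sdefect) => m; rewrite E.
Qed.

Definition quadratic_bound f (B : R) :=
  exists C, forall m, `|f m| <= B * m%:R ^+ 2 + C.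

(** The sum over [d >= 2] multiplies [B] by at most [3 / 4]; the additive
    constants in the bounds for [f (m %/ d)] add up to a linear term.  This term and
    [g] each cost [B / 16], whence [3 / 4 + 1 / 16 + 1 / 16 = 7 / 8]. *)
Lemma quadratic_bound_improve f g (B : R) : 0 < B ->
  subquadratic g ->
  (forall m, `|f m| <= `|g m| + \sum_(2 <= d < m.+1) `|f (m %/ d)%N|) ->
  quadratic_bound f B -> quadratic_bound f (7 / 8 * B).
Proof.
move=> B0 sg fg [C fC].
have B16 : 0 < B / 16 by lra.
have [C1 H1] := sg _ B16.
have [C2 H2] := subquadratic_linear `|C| 0 B16.
exists (C1 + C2) => m; apply: le_trans (fg m) _.
have S : \sum_(2 <= d < m.+1) `|f (m %/ d)%N| <=
    B * m%:R ^+ 2 * (3 / 4) + `|C| * m%:R.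
  apply: (@le_trans _ _ (\sum_(2 <= d < m.+1)
      (B * m%:R ^+ 2 * (d%:R ^+ 2)^-1 + `|C|))).
    apply: ler_sum => d _; apply: le_trans (fC _) _.
    by rewrite lerD ?ler_norm// -mulrA ler_wpM2l ?(ltW B0)// sqr_quotient_le.
  rewrite big_split/= -big_distrr/= lerD//.
    apply: ler_wpM2l; last exact: sum_inv_sqr_from2_le.
    by rewrite mulr_ge0 ?sqr_ge0// ltW.
  rewrite big_const_nat iter_addr_0 -(mulr_natr `|C|) ler_wpM2l// ler_nat.
  by rewrite subSS leq_subr.
have := H1 m; have := le_trans (ler_norm _) (H2 m).
rewrite addr0; lra.
Qed.

Lemma subquadratic_of_self_bound f g :
  quadratic_bound f 1 -> subquadratic g ->
  (forall m, `|f m| <= `|g m| + \sum_(2 <= d < m.+1) `|f (m %/ d)%N|) ->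
  subquadratic f.
Proof.
move=> f1 sg fg e e0.
have bnd k : quadratic_bound f ((7 / 8) ^+ k).
  elim: k => [|k IHk]; first by rewrite expr0.
  rewrite exprS; apply: (quadratic_bound_improve _ sg fg IHk).
  by rewrite exprn_gt0//; lra.
have q1 : `|7 / 8 : R| < 1 by rewrite ger0_norm; lra.
have /cvgr0Pnorm_le/(_ e e0)[N _ /(_ N (leqnn N)) HN] := cvg_expr q1.
have [C H] := bnd N; exists C => m; apply: le_trans (H m) _.
by rewrite lerD2r ler_wpM2r ?sqr_ge0// (le_trans (ler_norm _)).
Qed.

(** Subtracting from the sum identity for [W] the product of
    [6 / pi ^ 2] by [\sum_d (m %/ d) ^ 2 = pi ^ 2 / 6 * m ^ 2 + o(m ^ 2)]
    shows that the error term has subquadratic sums, so isolating [d = 1] gives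
    the self-bound of [subquadratic_of_self_bound]. *)
Theorem sum_quotient_inversion (W : nat -> R) :
  (forall m, 0 <= W m <= m%:R ^+ 2) ->
  (forall m, \sum_(1 <= d < m.+1) W (m %/ d)%N = m%:R ^+ 2) ->
  subquadratic (fun m => W m - 6 / pi ^+ 2 * m%:R ^+ 2).
Proof.
move=> Wb Wsum; set c : R := 6 / pi ^+ 2; pose f m := W m - c * m%:R ^+ 2.
have p0 : 0 < pi ^+ 2 :> R by rewrite exprn_gt0// pi_gt0.
have c0 : 0 < c by rewrite divr_gt0.
have c1 : c <= 1.
  rewrite -invf_ge1// invf_div.
  (* The first partial sum gives [1 <= pi ^ 2 / 6]. *)
  have := zeta2_partial_le R 1; rewrite /zeta2_partial big_nat1 expr1n invr1.
  by [].
have fsum m : \sum_(1 <= d < m.+1) f (m %/ d)%N =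
    c * (pi ^+ 2 / 6 * m%:R ^+ 2 - \sum_(1 <= d < m.+1) (m %/ d)%:R ^+ 2).
  rewrite sumrB Wsum -big_distrr/= mulrBr; congr (_ - _).
  by rewrite /c; move: pi (lt0r_neq0 (pi_gt0 R)) => p p_neq0; field.
apply: (subquadratic_of_self_bound _ (subquadraticZ c subquadratic_sum_sqr_quotient)).
  exists 0 => m; rewrite addr0 mul1r ler_norml.
  have /andP[w0 w1] := Wb m; have s0 : 0 <= m%:R ^+ 2 :> R by [].
  by apply/andP; split; nra.
move=> m; rewrite -fsum; case: m => [|m].
  rewrite !big_geq// normr0 addr0.
  have := Wb 0%N; rewrite expr0n/= -eq_le eq_sym => /eqP ->.
  by rewrite mulr0 subrr normr0.
rewrite -/(f m.+1) [in leRHS]big_ltn//= divn1.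
set S := \sum_(2 <= i < m.+2) f _.
have -> : f m.+1 = (f m.+1 + S) - S by rewrite addrK.
apply: le_trans (ler_normB _ _) _; rewrite addrK lerD2l.
exact: ler_norm_sum.
Qed.

End Subquadratic.

(** * The density *)

Theorem theorem2 (R : realType) :
  (fun n : nat => (#|` fset_set (visible_in_grid R n)|)%:R / n%:R ^+ 2 : R)
    @ \oo --> (6 / pi ^+ 2 : R).
Proof.
apply: (@cvg_of_subquadratic R _
  (fun n => (#|` fset_set (visible_in_grid R n)|)%:R)).
set c : R := 6 / pi ^+ 2.
have sW : subquadratic (fun m => (coprime_pairs m)%:R - c * m%:R ^+ 2 : R).
  apply: sum_quotient_inversion => m.
    by rewrite ler0n -natrX ler_nat coprime_pairs_le.
  by rewrite -natrX -sum_coprime_pairs natr_sum.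
have s4 := subquadraticZ 4 (subquadratic_half sW).
(* Replacing [4 * n./2 ^ 2] by [n ^ 2] and dropping the points on the axes
   changes the count by at most a linear amount. *)
have slin : subquadratic (fun n => 4 + 4 * `|c| + 4 * `|c| * n%:R : R).
  have := @subquadratic_linear R (4 * `|c|) (4 + 4 * `|c|).
  by apply: subquadratic_le => m; rewrite addrC.
have srest : subquadratic
    (fun n => 4 * (1 < n)%N%:R - c * (n%:R ^+ 2 - 4 * n./2%:R ^+ 2) : R).
  apply: subquadratic_le slin => n.
  have nE : n%:R = (odd n)%:R + 2 * n./2%:R :> R.
    by rewrite -natrM -natrD mul2n odd_double_half.
  have h0 : 0 <= n./2%:R :> R by [].
  have c0 := normr_ge0 c.
  have o1 : (odd n)%:R ^+ 2 = (odd n)%:R :> R.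
    by case: (odd n); rewrite ?expr1n ?expr0n.
  have -> : n%:R ^+ 2 - 4 * n./2%:R ^+ 2 = (odd n)%:R * (1 + 4 * n./2%:R) :> R.
    by rewrite nE mulrDr mulr1 -[in RHS]o1; ring: o1.
  rewrite [leRHS]ger0_norm; last by rewrite !addr_ge0 ?mulr_ge0.
  apply: le_trans (ler_normB _ _) _; rewrite -addrA lerD//.
    by rewrite ger0_norm ?mulr_ge0// ler_piMr// lern1 leq_b1.
  have o2 : (odd n)%:R <= 1 :> R by rewrite lern1 leq_b1.
  have o0 : 0 <= (odd n)%:R :> R by [].
  have key : `|(odd n)%:R * (1 + 4 * n./2%:R)| <= 4 + 4 * n%:R :> R.
    by rewrite ger0_norm ?mulr_ge0 ?addr_ge0 ?mulr_ge0// nE; nra.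
  by rewrite normrM; have := ler_wpM2l c0 key; lra.
apply: subquadratic_le (subquadraticD s4 srest) => n.
rewrite card_visible_in_grid natrD !natrM.
by rewrite le_eqVlt; apply/predU1P; left; congr (`| _ |); ring.
Qed.
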